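(* Let $A=[a_{ij}]$ be a fully indecomposable $n\times n$ $(0,1)$-matrix with row sum vector $(r_1,\ldots,r_n)$ and column sum vector $(s_1,\ldots,s_n)$. (i) Let $u=(u_1,\ldots,u_n)$ and $v=(v_1,\ldots,v_n)$ be real vectors, and define $Y=Y(u,v)=[y_{ij}]$ by $y_{ij}=u_i+v_j$ if $a_{ij}=1$ and $y_{ij}=0$ otherwise. Assume that $y_{ij}>0$ whenever $a_{ij}=1$, and that all row and column sums of $Y$ equal some positive number $\alpha$, i.e. \[ u_ir_i+\sum_{j:\,a_{ij}=1}v_j=\alpha\ (i\le n),\qquad v_js_j+\sum_{i:\,a_{ij}=1}u_i=\alpha\ (j\le n). \] Then $X=(1/\alpha)Y(u,v)$ is an RCDS doubly stochastic matrix determined by $A$. (ii) Conversely, if $X$ is an RCDS doubly stochastic matrix determined by $A$, then $X=(1/\alpha)Y(u,v)$ as in (i) for some real vectors $u,v$, where $\alpha$ is the common value of the row and column sums of $Y(u,v)$.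
   Context: A square nonnegative matrix is doubly stochastic if all its row and column sums equal $1$. An $n\times n$ matrix is partly decomposable if, after permuting rows and columns, it has the form $\begin{bmatrix}A_1&A_2\\ O&A_3\end{bmatrix}$ with $A_1,A_3$ square and nonempty; otherwise it is fully indecomposable. For a permutation $\sigma$ of $\{1,\ldots,n\}$, the diagonal of an $n\times n$ matrix $X=[x_{ij}]$ corresponding to $\sigma$ is the set of positions $(i,\sigma(i))$, $i=1,\ldots,n$, and its diagonal sum is $\sum_i x_{i,\sigma(i)}$. For a matrix $X$, $\xi(X)$ denotes the set of positions of its zero entries; a diagonal avoids $\xi(X)$ if none of its positions lies in $\xi(X)$. Given a fully indecomposable $(0,1)$-matrix $A$, an RCDS doubly stochastic matrix determined by $A$ is a doubly stochastic matrix $X$ with $\xi(X)=\xi(A)$ such that all diagonals of $X$ avoiding $\xi(X)$ have the same diagonal sum. *)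

(* Defs.v *)
From mathcomp Require Export all_boot all_order all_fingroup all_algebra.
From mathcomp Require Export reals.

Set Implicit Arguments.
Unset Strict Implicit.
Unset Printing Implicit Defensive.

Import Order.TTheory GRing.Theory Num.Theory.
Local Open Scope ring_scope.

Section Definitions.
Variables (R : realType) (n : nat).
Implicit Types (A X : 'M[R]_n) (s : 'S_n) (u v : 'rV[R]_n).

Definition zero_one A : Prop := forall i j, A i j = 0 \/ A i j = 1.

Definition row_sum X (i : 'I_n) : R := \sum_j X i j.
Definition col_sum X (j : 'I_n) : R := \sum_i X i j.

Definition doubly_stochastic X : Prop :=
  [/\ forall i j, 0 <= X i j,
      forall i, row_sum X i = 1
    & forall j, col_sum X j = 1].

Definition partly_decomposable A : Prop :=
  exists (k m : nat) (e : (k + m)%N = n) (s t : 'S_n)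
         (A1 : 'M[R]_k) (A2 : 'M[R]_(k, m)) (A3 : 'M[R]_m),
    [/\ (0 < k)%N, (0 < m)%N
      & row_perm s (col_perm t A) = castmx (e, e) (block_mx A1 A2 0 A3)].

Definition fully_indecomposable A : Prop := ~ partly_decomposable A.

Definition diagonal s : {set 'I_n * 'I_n} := [set (i, s i) | i : 'I_n].

Definition diag_sum X s : R := \sum_i X i (s i).

Definition zeros X : {set 'I_n * 'I_n} := [set p | X p.1 p.2 == 0].

Definition avoids s (Z : {set 'I_n * 'I_n}) : Prop := [disjoint diagonal s & Z].

Definition RCDS A X : Prop :=
  [/\ doubly_stochastic X,
      zeros X = zeros A
    & forall s t, avoids s (zeros X) -> avoids t (zeros X) ->
        diag_sum X s = diag_sum X t].

Definition Ymx A u v : 'M[R]_n :=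
  \matrix_(i, j) (if A i j == 1 then u 0 i + v 0 j else 0).

Definition Ypositive A u v : Prop :=
  forall i j, A i j = 1 -> 0 < Ymx A u v i j.

Definition Yline_sums A u v (alpha : R) : Prop :=
  (forall i, row_sum (Ymx A u v) i = alpha) /\
  (forall j, col_sum (Ymx A u v) j = alpha).

End Definitions.

(* Main.v *)
Require Import Defs.
From mathcomp Require Import zify ring lra.

(** For the converse, call c the common sum of the diagonals of X inside the
    pattern of A. By Birkhoff's theorem, <X, M> = c t for every nonnegative M
    inside the pattern with all line sums t. If Z lies inside the pattern and
    has zero line sums, then K X + Z is nonnegative for K large, because X is
    positive on the pattern; comparing its product with X to that of K X gives
    <X, Z> = 0. Hence X is orthogonal to the kernel of the line-sum map on the
    pattern, so it is a combination of line indicators there, which is to say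
    x_ij = u_i + v_j. *)

Set Implicit Arguments.
Unset Strict Implicit.
Unset Printing Implicit Defensive.

Import Order.TTheory GRing.Theory Num.Theory.
Local Open Scope ring_scope.

(** * Hall's marriage theorem for finite families of sets *)

Section Hall.
Local Open Scope nat_scope.
Variables (I J : finType) (j0 : J).
Implicit Types (N : I -> {set J}) (S T : {set I}).

Definition hall_condition N S :=
  forall T, T \subset S -> #|T| <= #|\bigcup_(i in T) N i|.

Definition has_transversal N S :=
  exists2 f : I -> J, {in S &, injective f} & {in S, forall i, f i \in N i}.

Lemma bigcup_setD N (B : {set J}) T :
  \bigcup_(i in T) (N i :\: B) = (\bigcup_(i in T) N i) :\: B.
Proof.
apply/setP=> y; apply/bigcupP/idP => [[i iT]|]; rewrite inE.
  by case/andP=> yB yN; rewrite inE yB; apply/bigcupP; exists i.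
by case/andP=> yB /bigcupP[i iT yN]; exists i; rewrite // inE yB.
Qed.

(** Values chosen on [T] lie in [B] and values chosen on the rest avoid [B], so the two injective
    choices cannot collide. *)
Lemma transversal_glue N S T (B : {set J}) :
  has_transversal (fun i => N i :&: B) T ->
  has_transversal (fun i => N i :\: B) (S :\: T) ->
  has_transversal N S.
Proof.
move=> [f f_inj fN] [g g_inj gN].
have gP i : i \in S -> i \notin T -> (g i \notin B) && (g i \in N i).
  by move=> iS iT; have := gN i; rewrite !inE iS iT; apply.
have fP i : i \in T -> (f i \in N i) && (f i \in B).
  by move=> iT; have := fN i iT; rewrite inE.
exists (fun i => if i \in T then f i else g i) => [i k iS kS|i iS] /=; last first.
  by case: ifP => [/fP/andP[]//|/negbT iT]; case/andP: (gP i iS iT).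
case: ifP => [iT|/negbT iT]; case: ifP => [kT|/negbT kT]; first exact: f_inj.
- by move=> e; case/andP: (fP i iT) => _; rewrite e;
  case/andP: (gP k kS kT) => /negbTE->.
- by move=> e; case/andP: (fP k kT) => _; rewrite -e;
  case/andP: (gP i iS iT) => /negbTE->.
- by apply: g_inj; rewrite inE ?iT ?kT.
Qed.

(* Halmos-Vaughan: either some proper nonempty T is tight, and T and its
   complement are matched separately, or any single edge can be removed. *)
Lemma hall_marriage N S : hall_condition N S -> has_transversal N S.
Proof.
have [m] := ubnP #|S|; elim: m N S => // m IHm N S leSm hallS.
have [->|[x xS]] := set_0Vmem S.
  by exists (fun=> j0) => i; rewrite ?inE.
have [[T [T0 TS tight]]|loose] :
    (exists T, [/\ T != set0, T \proper S & #|\bigcup_(i in T) N i| <= #|T|])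
    \/ (forall T, T != set0 -> T \proper S -> #|T| < #|\bigcup_(i in T) N i|).
- have [/existsP[T /and3P[? ? ?]]|] := boolP [exists T : {set I},
    [&& T != set0, T \proper S & #|\bigcup_(i in T) N i| <= #|T|]].
    by left; exists T.
  rewrite negb_exists => /forallP loose; right=> T T0 TS.
  by have := loose T; rewrite T0 TS /= -ltnNge.
- have sTS := proper_sub TS; have ltTS := proper_card TS.
  apply: (@transversal_glue _ _ T (\bigcup_(i in T) N i)).
    have [||f f_inj fN] := IHm N T; first by lia.
      by move=> U UT; apply: hallS; apply: subset_trans UT sTS.
    exists f => // i iT; rewrite inE fN //=.
    by apply/bigcupP; exists i; rewrite ?fN.
  apply: IHm; first by rewrite cardsDS //; rewrite -card_gt0 in T0; lia.
  move=> U; rewrite subsetD => /andP[US dUT]; rewrite bigcup_setD.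
  (* As N(T) has at most |T| elements, Hall's condition for the disjoint union of [U] and [T] leaves
     at least |U| neighbours of [U] outside N(T). *)
  have := hallS (U :|: T); rewrite subUset US sTS => /(_ isT).
  rewrite cardsU (disjoint_setI0 dUT) cards0 subn0 bigcup_setU.
  set P := \bigcup_(i in U) N i; set Q := \bigcup_(i in T) N i.
  by have := cardsID Q P; rewrite cardsU -/Q in tight *; lia.
- have : 0 < #|N x|.
    have := hallS [set x]; rewrite sub1set xS big_set1 cards1; exact.
  case/card_gt0P=> y yN; apply: (@transversal_glue _ _ [set x] [set y]).
    exists (fun=> y) => [i k|i]; rewrite !inE; first by move=> /eqP-> /eqP->.
    by move=> /eqP->; rewrite yN eqxx.
  apply: IHm; first by have := cardsD1 x S; rewrite xS; lia.
  move=> U; rewrite subsetD1 => /andP[US xU]; rewrite bigcup_setD.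
  have [->|U0] := eqVneq U set0; first by rewrite cards0.
  (* [U] misses [x], so it is proper in [S], and the strict inequality pays for the loss of [y]. *)
  have := loose U U0; rewrite properE US => /(_ _)/implyP.
  have -> /= : ~~ (S \subset U) by apply: contra xU => /subsetP; apply.
  by set P := \bigcup_(i in U) N i; have := cardsD1 y P; lia.
Qed.
End Hall.

(** * Line sums and the entrywise inner product *)

Section LineSums.
Variables (R : realType) (n : nat).
Implicit Types (A X M Z : 'M[R]_n).

Definition line_sums M (t : R) : Prop :=
  (forall i, row_sum M i = t) /\ (forall j, col_sum M j = t).

Definition frobenius X M : R := \sum_i \sum_j X i j * M i j.

Lemma frobeniusDr X M Z : frobenius X (M + Z) = frobenius X M + frobenius X Z.
Proof.
rewrite /frobenius -big_split; apply: eq_bigr => i _.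
by rewrite -big_split; apply: eq_bigr => j _; rewrite mxE mulrDr.
Qed.

Lemma frobeniusZr X M a : frobenius X (a *: M) = a * frobenius X M.
Proof.
rewrite /frobenius big_distrr; apply: eq_bigr => i _.
by rewrite big_distrr; apply: eq_bigr => j _; rewrite mxE mulrCA.
Qed.

Lemma frobenius_perm_mx X (s : 'S_n) : frobenius X (perm_mx s) = diag_sum X s.
Proof.
apply: eq_bigr => i _; rewrite (bigD1 (s i)) //= !mxE eqxx mulr1 big1 ?addr0 //.
by move=> j /negbTE ne; rewrite !mxE eq_sym ne mulr0.
Qed.

Lemma line_sumsD M Z a b :
  line_sums M a -> line_sums Z b -> line_sums (M + Z) (a + b).
Proof.
move=> [Mr Mc] [Zr Zc]; split=> i.
  by rewrite -(Mr i) -(Zr i) /row_sum -big_split; apply: eq_bigr => j _; rewrite mxE.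
by rewrite -(Mc i) -(Zc i) /col_sum -big_split; apply: eq_bigr => j _; rewrite mxE.
Qed.

Lemma line_sumsZ M a b : line_sums M a -> line_sums (b *: M) (b * a).
Proof.
move=> [Mr Mc]; split=> i.
  by rewrite -(Mr i) /row_sum big_distrr; apply: eq_bigr => j _; rewrite mxE.
by rewrite -(Mc i) /col_sum big_distrr; apply: eq_bigr => j _; rewrite mxE.
Qed.

Lemma line_sums_perm_mx (s : 'S_n) : line_sums (perm_mx s) 1.
Proof.
split=> i; rewrite /row_sum /col_sum.
  rewrite (bigD1 (s i)) //= !mxE eqxx big1 ?addr0 // => j /negbTE ne.
  by rewrite !mxE eq_sym ne.
rewrite (bigD1 (s^-1%g i)) //= !mxE permKV eqxx big1 ?addr0 // => j ne.
rewrite !mxE; case: eqP => // e; by rewrite -e permK eqxx in ne.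
Qed.

(** * Positive diagonals and Birkhoff's theorem *)

(** Hall's condition follows by weighing: the rows in [T] carry total weight t|T|, all of it in the
    columns [P] where they are positive, and these carry t|P|. *)
Lemma positive_diagonal M t :
  (forall i j, 0 <= M i j) -> line_sums M t -> 0 < t ->
  exists s : 'S_n, forall i, 0 < M i (s i).
Proof.
move=> M0 [Mr Mc] t0.
(* Hall's theorem needs a default column; without one n = 0 and the identity works vacuously. *)
have [j0 _|n0] := pickP (fun _ : 'I_n => true); last first.
  by exists 1%g => i; have := n0 i.
pose N i := [set j | 0 < M i j].
have [|f f_inj fN] := @hall_marriage _ _ j0 N setT.
  move=> T _; set P := \bigcup_(i in T) N i.
  rewrite -(ler_nat R) -(ler_pM2l t0) !mulr_natr -!sumr_const.
  rewrite -(eq_bigr _ (fun i _ => Mr i)) -(eq_bigr _ (fun j _ => Mc j)).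
  rewrite /row_sum /col_sum [leRHS]exchange_big /=.
  apply: (@le_trans _ _ (\sum_(i in T) \sum_(j in P) M i j)).
    apply: ler_sum => i iT; rewrite (bigID (mem P)) /= [X in _ + X]big1 ?addr0 //.
    move=> j jP; apply/eqP; rewrite eq_le M0 andbT leNgt.
    by apply: contra jP => Mij; apply/bigcupP; exists i; rewrite ?inE.
  rewrite [leRHS](bigID (mem T)) /= lerDl.
  by apply: sumr_ge0 => i _; apply: sumr_ge0.
have f_inj' : injective f by move=> i k; apply: f_inj; rewrite inE.
by exists (perm f_inj') => i; rewrite permE; have := fN i; rewrite !inE; apply.
Qed.

(* Birkhoff's decomposition, in the dual form: a functional that takes the
   value c on every permutation matrix inside the pattern takes the value c t
   on every nonnegative matrix of line sums t inside it. *)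
Lemma frobenius_line_sums X A c M t :
  (forall s, avoids s (zeros A) -> diag_sum X s = c) ->
  (0 < n)%N -> (forall i j, 0 <= M i j) -> line_sums M t ->
  (forall i j, A i j = 0 -> M i j = 0) -> frobenius X M = c * t.
Proof.
move=> Xc n0.
have [m] := ubnP #|~: zeros M|; elim: m M t => // m IHm M t leMm M0 Mt AM.
pose i0 := Ordinal n0.
have : 0 <= t by rewrite -(Mt.1 i0); apply: sumr_ge0.
rewrite le_eqVlt => /predU1P[t0|t_gt0].
  have Mz i j : M i j = 0.
    have /eqP := Mt.1 i; rewrite -t0 psumr_eq0 // => /allP/(_ j).
    by rewrite mem_index_enum => /(_ isT)/eqP.
  rewrite -t0 mulr0; apply: big1 => i _; apply: big1 => j _.
  by rewrite Mz mulr0.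
have [s Ms] := positive_diagonal M0 Mt t_gt0.
have sA : avoids s (zeros A).
  apply/pred0P=> p /=; apply/negP=> /andP[/imsetP[i _ ->]].
  by rewrite inE /= => /eqP/AM e; have := Ms i; rewrite e ltxx.
(* Subtracting the least entry along the diagonal keeps the matrix nonnegative and creates a zero at
   [(k, s k)], so the support shrinks. *)
have [k _ kmin] := arg_minP (fun i => M i (s i)) (erefl : xpredT i0).
set e := M k (s k) in kmin; pose P : 'M[R]_n := perm_mx s.
have ME : M = (M - e *: P) + e *: P by rewrite subrK.
have Pt := line_sumsZ e (line_sums_perm_mx s).
have M't : line_sums (M - e *: P) (t - e).
  by have := line_sumsD Mt (line_sumsZ (-1) Pt); rewrite !scaleN1r mulN1r mulr1.
have M'E i j : (M - e *: P) i j = if s i == j then M i j - e else M i j.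
  by rewrite !mxE; case: eqP => _; rewrite ?mulr1 // mulr0 subr0.
rewrite {1}ME frobeniusDr frobeniusZr frobenius_perm_mx Xc // (IHm _ (t - e)) //.
- by ring.
- rewrite ltnS in leMm; apply: leq_trans leMm; apply: proper_card.
  rewrite properC; apply/properP; split.
    apply/subsetP=> -[i j]; rewrite !inE /= => /eqP Mij; rewrite M'E Mij.
    have [sij|_] := eqVneq (s i) j; last by rewrite eqxx.
    by have := Ms i; rewrite sij Mij ltxx.
  exists (k, s k); rewrite !inE /= ?M'E ?eqxx ?subrr //.
  by rewrite gt_eqF.
- by move=> i j; rewrite M'E; case: eqP => // <-; rewrite subr_ge0 kmin.
- move=> i j Aij; rewrite M'E AM //; case: eqP => // sij.
  by have := Ms i; rewrite sij AM // ltxx.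
Qed.

(** * Orthogonality to the zero-line-sum matrices of the pattern *)

Lemma rcds_orthogonal A X Z :
  RCDS A X -> line_sums Z 0 -> (forall i j, A i j = 0 -> Z i j = 0) ->
  frobenius X Z = 0.
Proof.
move=> [[X0 Xr Xc] XA Xd] Zt AZ.
have [i0 _|n0] := pickP (fun _ : 'I_n => true); last first.
  by apply: big1 => i; have := n0 i.
have n_gt0 : (0 < n)%N by apply: leq_ltn_trans (ltn_ord i0).
have Xt : line_sums X 1 by [].
have eqXA i j : (X i j == 0) = (A i j == 0).
  by move/setP/(_ (i, j)): XA; rewrite !inE.
have AX i j : A i j = 0 -> X i j = 0.
  by move=> Aij; apply/eqP; rewrite eqXA Aij.
(* The sum along this one diagonal inside the pattern serves as the common value c. *)
have [s Xs] := positive_diagonal X0 Xt ltr01.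
have sA : avoids s (zeros X).
  apply/pred0P=> p /=; apply/negP=> /andP[/imsetP[i _ ->]].
  by rewrite inE /= gt_eqF.
have Xcst t : avoids t (zeros A) -> diag_sum X t = diag_sum X s.
  by rewrite -XA => /Xd; apply.
(* K X + Z is nonnegative because each summand of K dominates its own entry. *)
pose K := \sum_i \sum_j `|Z i j| / X i j.
have KZ i j : 0 <= (K *: X + Z) i j.
  rewrite !mxE; have [/eqP|Xij] := eqVneq (X i j) 0.
    by rewrite eqXA => /eqP Aij; rewrite AX ?AZ // mulr0 addr0.
  have Xp : 0 < X i j by rewrite lt_neqAle eq_sym Xij X0.
  have : `|Z i j| / X i j <= K.
    (* Where [X] vanishes the quotient is 0 by convention. *)
    have q0 a b : 0 <= `|Z a b| / X a b by rewrite divr_ge0.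
    rewrite /K (bigD1 i) //= (bigD1 j) //= -addrA lerDl addr_ge0 //.
      by apply: sumr_ge0.
    by apply: sumr_ge0 => a _; apply: sumr_ge0.
  rewrite ler_pdivrMr // => le; have := ler_norm (- Z i j).
  by rewrite normrN; lra.
have Kt := line_sumsD (line_sumsZ K Xt) Zt.
(* [K X + Z] and [X] have line sums K and 1, so <X, K X + Z> = c K = K <X, X>. *)
have := frobenius_line_sums Xcst n_gt0 KZ Kt.
have := frobenius_line_sums Xcst n_gt0 X0 Xt AX.
rewrite frobeniusDr frobeniusZr => -> /(_ _)/(canRL (addKr _)) -> //.
  by ring.
by move=> i j Aij; rewrite !mxE AX ?AZ // mulr0 addr0.
Qed.

(** * From orthogonality to the additive form, by linear algebra on flattened matrices *)

Lemma mxvec_sum X (w : 'I_(n * n) -> R) :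
  \sum_l mxvec X 0 l * w l = \sum_i \sum_j X i j * w (mxvec_index i j).
Proof.
rewrite pair_bigA /= (reindex _ (@curry_mxvec_bij n n)) /=.
by apply: eq_bigr => -[i j] _; rewrite mxvecE.
Qed.

(** This is the vertex-edge incidence matrix of the bipartite graph of [A], with a zero column for
    each non-edge; its row space consists of the matrices u_i + v_j masked by the support. *)
Definition line_mx A : 'M[R]_(n + n, n * n) :=
  col_mx (\matrix_i mxvec (\matrix_(a, b) ((a == i) && (A a b != 0))%:R))
         (\matrix_j mxvec (\matrix_(a, b) ((b == j) && (A a b != 0))%:R)).

(* The annihilator of the zero-line-sum matrices inside the pattern is the
   span of the masked line indicators. *)
Lemma additive_on_support A X :
  (forall i j, A i j = 0 -> X i j = 0) ->
  (forall Z, line_sums Z 0 -> (forall i j, A i j = 0 -> Z i j = 0) ->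
    frobenius X Z = 0) ->
  exists u v : 'rV[R]_n, forall i j, A i j != 0 -> X i j = u 0 i + v 0 j.
Proof.
move=> AX Xorth.
have : (mxvec X <= line_mx A)%MS.
  rewrite submxE; apply/eqP/rowP=> k; rewrite mxE [RHS]mxE mxvec_sum.
  (* Membership in the row space is tested against each column of the cokernel. Such a column,
     masked and read as a matrix [Z], has zero line sums because [line_mx A] kills it. *)
  pose w l := cokermx (line_mx A) l k.
  pose Z : 'M[R]_n := \matrix_(a, b) ((A a b != 0)%:R * w (mxvec_index a b)).
  have Bw q : \sum_l line_mx A q l * w l = 0.
    by have /matrixP/(_ q k) := mulmx_coker (line_mx A); rewrite mxE [RHS]mxE.
  rewrite -[RHS](Xorth Z).
  - apply: eq_bigr => i _; apply: eq_bigr => j _; rewrite [Z i j]mxE.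
    by have [/AX->|_] := eqVneq (A i j) 0; rewrite ?mul0r //= mul1r.
  - split=> i.
      rewrite -[RHS](Bw (lshift n i)) /row_sum.
      under [RHS]eq_bigr => l _ do rewrite col_mxEu mxE.
      rewrite mxvec_sum [RHS](bigD1 i) //= [X in _ + X]big1 ?addr0 => [|a /negbTE ne].
        by apply: eq_bigr => j _; rewrite !mxE eqxx.
      by apply: big1 => b _; rewrite mxE ne mul0r.
    rewrite -[RHS](Bw (rshift n i)) /col_sum.
    under [RHS]eq_bigr => l _ do rewrite col_mxEd mxE.
    rewrite mxvec_sum; apply: eq_bigr => a _.
    rewrite [RHS](bigD1 i) //= [X in _ + X]big1 ?addr0 => [|b /negbTE ne].
      by rewrite !mxE eqxx.
    by rewrite mxE ne mul0r.
  - by move=> i j Aij; rewrite mxE Aij eqxx mul0r.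
(* The coefficients of the row indicators form u, those of the column indicators form v. *)
case/submxP=> D XD; exists (lsubmx D), (rsubmx D) => i j Aij.
rewrite -(mxvecE X) XD -{1}[D]hsubmxK mul_row_col mxE.
congr (_ + _); rewrite mxE.
  rewrite (bigD1 i) //= !mxE mxvecE mxE eqxx Aij mulr1 big1 ?addr0 // => a ne.
  by rewrite [X in _ * X]mxE mxvecE mxE eq_sym (negbTE ne) mulr0.
rewrite (bigD1 j) //= !mxE mxvecE mxE eqxx Aij mulr1 big1 ?addr0 // => a ne.
by rewrite [X in _ * X]mxE mxvecE mxE eq_sym (negbTE ne) mulr0.
Qed.

(** * Passage between RCDS matrices and the matrices [Ymx] *)

(** A diagonal inside the pattern uses each u_i and each v_j exactly once, whatever [s] is. *)
Lemma diag_sum_Ymx A u v (s : 'S_n) : zero_one A -> avoids s (zeros A) ->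
  diag_sum (Ymx A u v) s = \sum_i u 0 i + \sum_i v 0 i.
Proof.
move=> A01 sA; rewrite [X in _ + X](reindex_perm s) -big_split.
apply: eq_bigr => i _; rewrite mxE; case: (A01 i (s i)) => [Ai|->]; last first.
  by rewrite eqxx.
have /pred0P/(_ (i, s i)) /= := sA; rewrite inE /= Ai eqxx andbT.
by move/negbT/negP; case; apply: imset_f.
Qed.

Lemma rcds_of_Ymx A u v alpha : zero_one A -> 0 < alpha ->
  Ypositive A u v -> Yline_sums A u v alpha -> RCDS A (alpha^-1 *: Ymx A u v).
Proof.
move=> A01 a0 Ypos Yls.
have Y0 i j : (Ymx A u v i j == 0) = (A i j == 0).
  have [Aij|Aij] := A01 i j; last by rewrite gt_eqF ?Ypos // Aij oner_eq0.
  by rewrite mxE Aij (eq_sym 0 1) oner_eq0 !eqxx.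
have [Xr Xc] : line_sums (alpha^-1 *: Ymx A u v) 1.
  by rewrite -(mulVf (lt0r_neq0 a0)); apply: line_sumsZ.
have XA : zeros (alpha^-1 *: Ymx A u v) = zeros A.
  apply/setP=> -[i j]; rewrite !inE /= -Y0 [X in X == 0]mxE mulf_eq0.
  by rewrite invr_eq0 gt_eqF.
have Xd s : avoids s (zeros A) ->
    diag_sum (alpha^-1 *: Ymx A u v) s = alpha^-1 * (\sum_i u 0 i + \sum_i v 0 i).
  move=> sA; rewrite -(diag_sum_Ymx _ _ A01 sA) /diag_sum big_distrr.
  by apply: eq_bigr => i _; rewrite mxE.
split=> //; last by rewrite XA => s t sA tA; rewrite !Xd.
split=> // i j; rewrite mxE pmulr_rge0 ?invr_gt0 //.
have [Aij|Aij] := A01 i j; last by apply/ltW/Ypos.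
by rewrite le_eqVlt eq_sym Y0 Aij eqxx.
Qed.

Lemma Ymx_of_rcds A X : zero_one A -> RCDS A X ->
  exists u v, [/\ Ypositive A u v, Yline_sums A u v 1 & X = Ymx A u v].
Proof.
move=> A01 XR; have [[X0 Xr Xc] XA _] := XR.
have eqXA i j : (X i j == 0) = (A i j == 0).
  by move/setP/(_ (i, j)): XA; rewrite !inE.
have [||u [v uv]] := @additive_on_support A X.
- by move=> i j Aij; apply/eqP; rewrite eqXA Aij.
- by move=> Z; apply: rcds_orthogonal.
have XY : X = Ymx A u v.
  apply/matrixP=> i j; rewrite mxE.
  have [Aij|Aij] := A01 i j; rewrite Aij.
    by rewrite eq_sym oner_eq0; apply/eqP; rewrite eqXA Aij.
  by rewrite eqxx uv // Aij oner_eq0.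
exists u, v; split=> //; last by rewrite /Yline_sums -XY.
by move=> i j Aij; rewrite -XY lt_neqAle X0 eq_sym eqXA Aij oner_eq0.
Qed.

(** * The line-sum condition as linear equations in u and v *)

Lemma row_sum_Ymx A u v i : zero_one A ->
  row_sum (Ymx A u v) i = u 0 i * row_sum A i + \sum_(j | A i j == 1) v 0 j.
Proof.
move=> A01; rewrite /row_sum big_distrr [X in _ + X]big_mkcond -big_split.
apply: eq_bigr => j _; rewrite mxE /=; have [->|->] := A01 i j.
  by rewrite eq_sym oner_eq0 mulr0 addr0.
by rewrite eqxx mulr1.
Qed.

Lemma col_sum_Ymx A u v j : zero_one A ->
  col_sum (Ymx A u v) j = v 0 j * col_sum A j + \sum_(i | A i j == 1) u 0 i.
Proof.
move=> A01; rewrite /col_sum big_distrr [X in _ + X]big_mkcond -big_split.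
apply: eq_bigr => i _; rewrite mxE /=; have [->|->] := A01 i j.
  by rewrite eq_sym oner_eq0 mulr0 addr0.
by rewrite eqxx mulr1 addrC.
Qed.

End LineSums.

Theorem theorem2p1 (R : realType) (n : nat) (A : 'M[R]_n) (r s : 'rV[R]_n)
    (A01 : zero_one A) (Afi : fully_indecomposable A)
    (rE : forall i, r 0 i = row_sum A i)
    (sE : forall j, s 0 j = col_sum A j) :
  (* the two forms of the line-sum condition, related by "i.e." in (i) *)
  (forall (u v : 'rV[R]_n) (alpha : R),
     Yline_sums A u v alpha <->
     (forall i, u 0 i * r 0 i + \sum_(j | A i j == 1) v 0 j = alpha) /\
     (forall j, v 0 j * s 0 j + \sum_(i | A i j == 1) u 0 i = alpha)) /\
  (* (i) *)
  (forall (u v : 'rV[R]_n) (alpha : R),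
     0 < alpha -> Ypositive A u v -> Yline_sums A u v alpha ->
     RCDS A (alpha^-1 *: Ymx A u v)) /\
  (* (ii) *)
  (forall X : 'M[R]_n, RCDS A X ->
     exists (u v : 'rV[R]_n) (alpha : R),
       [/\ 0 < alpha, Ypositive A u v, Yline_sums A u v alpha
         & X = alpha^-1 *: Ymx A u v]).
Proof.
split; [|split].
- move=> u v alpha; split=> -[Hr Hc]; split=> i.
  + by rewrite rE -row_sum_Ymx.
  + by rewrite sE -col_sum_Ymx.
  + by rewrite row_sum_Ymx // -rE.
  + by rewrite col_sum_Ymx // -sE.
- by move=> u v alpha; apply: rcds_of_Ymx.
- move=> X /(Ymx_of_rcds A01)[u [v [Ypos Yls XY]]].
  (* [X] already has line sums 1, so alpha = 1 serves without rescaling. *)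
  by exists u, v, 1; rewrite invr1 scale1r.
Qed.
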